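(* Let $R$ be a ring (not necessarily commutative), let $n \ge 1$ be an integer, and let $A, B \in M_n(R)$ be such that $C(A) = C(B)$, where $C(X) = \{Y \in M_n(R) : XY = YX\}$ for $X \in M_n(R)$. If the entries of $A$ commute with each other, then there exists a commutative subring $T$ of $R$ such that $A, B \in M_n(T)$.
   Context: Rings are associative with identity and not assumed commutative. $M_n(R)$ denotes the ring of $n \times n$ matrices with entries in $R$. For $X \in M_n(R)$, $C(X) = \{Y \in M_n(R) : XY = YX\}$ is the centralizer of $X$ in $M_n(R)$. For a subring $T$ of $R$, $M_n(T)$ is regarded as a subset of $M_n(R)$, so $A, B \in M_n(T)$ means that all entries of $A$ and $B$ lie in $T$. *)

(* Defs.v *)
From mathcomp Require Import all_boot all_order all_algebra.

Set Implicit Arguments.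
Unset Strict Implicit.
Unset Printing Implicit Defensive.

Import GRing.Theory.
Local Open Scope ring_scope.

Definition mxcent (R : pzRingType) (n : nat) (X : 'M[R]_n) : {pred 'M[R]_n} :=
  [pred Y | comm_mxb X Y].

(* T ranges over arbitrary subsets of R: classically, every subset is given by
   a boolean predicate. Subrings are unital, with the identity of R. *)
Definition commutative_subring (R : pzRingType) (T : {pred R}) : Prop :=
  subring_closed T /\ {in T &, commutative *%R}.

(* Main.v *)
Require Import Defs.
From mathcomp Require Import all_boot all_order all_algebra.
From mathcomp Require Import boolp.

(* For r in R, the scalar matrix r%:M centralizes X iff r commutes with every
   entry of X; so C(A) = C(B) says in particular that A and B have the same
   entrywise centralizer in R. Hence the entries of B lie in the bicommutant of
   the entries of A, which is commutative because those entries commute. *)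

Set Implicit Arguments.
Unset Strict Implicit.
Unset Printing Implicit Defensive.

Import GRing.Theory.
Local Open Scope ring_scope.

Definition entry_comm (R : pzRingType) (n : nat) (X : 'M[R]_n) (r : R) : Prop :=
  forall i j, GRing.comm (X i j) r.

Lemma scalar_mxcentP (R : pzRingType) (n : nat) (X : 'M[R]_n) (r : R) :
  reflect (entry_comm X r) (r%:M \in mxcent X).
Proof.
(* Viewed as a diagonal matrix, [r%:M] gives products without sums: the entries to compare are
   [X i j * r] and [r * X i j]. *)
rewrite inE -diag_const_mx /comm_mxb mul_mx_diag mul_diag_mx.
apply: (iffP eqP) => [/matrixP eqX i j | commX].
  by have := eqX i j; rewrite !mxE.
by apply/matrixP => i j; rewrite !mxE commX.
Qed.

(** The quantification over all of [R] is made boolean classically, to fit [{pred R}]. *)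
Definition bicommutant (R : pzRingType) (P : R -> Prop) : {pred R} :=
  [pred x | `[< forall r, (forall a, P a -> GRing.comm a r) -> GRing.comm x r >]].

Lemma bicommutantP (R : pzRingType) (P : R -> Prop) (x : R) :
  reflect (forall r, (forall a, P a -> GRing.comm a r) -> GRing.comm x r)
          (x \in bicommutant P).
Proof. exact: asboolP. Qed.

Lemma sub_bicommutant (R : pzRingType) (P : R -> Prop) (x : R) :
  P x -> x \in bicommutant P.
Proof. by move=> Px; apply/bicommutantP => r; apply. Qed.

Lemma bicommutant_subring (R : pzRingType) (P : R -> Prop) :
  subring_closed (bicommutant P).
Proof.
split=> [|x y /bicommutantP xP /bicommutantP yP|x y /bicommutantP xP /bicommutantP yP];
  apply/bicommutantP => r rP; apply: commr_sym.
- exact: commr1.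
- by apply: commrB; apply: commr_sym; [apply: xP | apply: yP].
- by apply: commrM; apply: commr_sym; [apply: xP | apply: yP].
Qed.

(** Any [y] in the bicommutant commutes with all of [P], since [P] lies in its own commutant; so [y]
    is itself in the commutant, and every [x] in the bicommutant commutes with it. *)
Lemma bicommutant_commutative (R : pzRingType) (P : R -> Prop) :
    (forall a b, P a -> P b -> GRing.comm a b) ->
  commutative_subring (bicommutant P).
Proof.
move=> commP; split=> [|x y /bicommutantP xP /bicommutantP yP].
  exact: bicommutant_subring.
apply: xP => a Pa; apply: commr_sym; apply: yP => b Pb; exact: commP.
Qed.

Theorem mainTheorem1 (R : pzRingType) (n : nat) (n_ge1 : (1 <= n)%N)
    (A B : 'M[R]_n)
    (eqC : mxcent A =i mxcent B)
    (commA : forall i j k l : 'I_n, GRing.comm (A i j) (A k l)) :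
  exists T : {pred R},
    [/\ commutative_subring T, A \is a mxOver T & B \is a mxOver T].
Proof.
exists (bicommutant (fun a => exists i j, a = A i j)); split.
- by apply: bicommutant_commutative => a b [i [j ->]] [k [l ->]].
- by apply/mxOverP => i j; apply: sub_bicommutant; exists i, j.
apply/mxOverP => i j; apply/bicommutantP => r rA.
(* As [r] commutes with the entries of [A], [eqC] can be applied at [r%:M]. *)
suff /scalar_mxcentP : r%:M \in mxcent B by apply.
by rewrite -eqC; apply/scalar_mxcentP => k l; apply: rA; exists k, l.
Qed.
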